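(* Let $\Omega$ be a locally compact Hausdorff space, and $E$ and $F$ be two Hilbert $C_0(\Omega)$-modules. Suppose that $\theta : E\to F$ is a $C_0(\Omega)$-module homomorphism (not assumed to be bounded) which preserves orthogonality. Then $\theta$ is bounded and there exists a bounded non-negative function $\varphi$ on $\Omega$ that is continuous on $\Omega_E$ and satisfies $\langle \theta(e), \theta(f) \rangle = \varphi \cdot \langle e, f \rangle$ for all $e,f\in E$.
   Context: $C_0(\Omega)$ is the $C^*$-algebra of continuous complex-valued functions on $\Omega$ vanishing at infinity. Hilbert $C_0(\Omega)$-modules are right Hilbert $C^*$-modules with $C_0(\Omega)$-valued inner product $\langle\cdot,\cdot\rangle$ satisfying $\langle x,ya\rangle=\langle x,y\rangle a$ and $\langle x,y\rangle^*=\langle y,x\rangle$, complete in the norm $\|x\|=\|\langle x,x\rangle\|^{1/2}$. A $C_0(\Omega)$-module homomorphism is a $\mathbb{C}$-linear map $\theta$ with $\theta(xa)=\theta(x)a$ for all $x\in E$, $a\in C_0(\Omega)$. The map $\theta$ preserves orthogonality if $\langle\theta(x),\theta(y)\rangle=0$ whenever $x,y\in E$ and $\langle x,y\rangle=0$. For $\omega\in\Omega$, let $K^E_\omega=\{e\in E:\langle e,e\rangle(\omega)=0\}$ and let $\Xi^E_\omega=E/K^E_\omega$ be the fibre of $E$ at $\omega$. Put $\Omega_E=\{\omega\in\Omega:\Xi^E_\omega\neq(0)\}$. *)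

(* Defs.v *)
From HB Require Import structures.
From mathcomp Require Import all_boot all_order all_algebra.
From mathcomp Require Import complex.
From mathcomp Require Import all_classical all_reals all_analysis.

Set Implicit Arguments.
Unset Strict Implicit.
Unset Printing Implicit Defensive.

Import Order.TTheory GRing.Theory Num.Theory.
Import numFieldNormedType.Exports.

Local Open Scope classical_set_scope.
Local Open Scope complex_scope.
Local Open Scope ring_scope.

Local Notation normc := (@ComplexField.Normc.normc _).

(* [R[i]] is the field of complex numbers.  Its topology is carried by the
   convertible type [R[i]^o], hence the cast in [c0_pred]; its order is the
   partial one, so that [0 <= z] means that z is real and nonnegative. *)

Section C0.
Context {R : realType} {T : topologicalType}.
Implicit Types f g : T -> R[i].

Definition vanishes_at_infinity f : Prop :=
  forall e : R, 0 < e ->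
    exists2 K : set T, compact K & forall w, ~ K w -> `|f w| < e%:C.

Definition c0_pred : {pred T -> R[i]} :=
  fun f => `[< continuous (f : T -> R[i]^o) /\ vanishes_at_infinity f >].

Lemma c0_predP f :
  reflect (continuous (f : T -> R[i]^o) /\ vanishes_at_infinity f)
          (f \in c0_pred).
Proof. exact: asboolP. Qed.

Lemma c0_pred0 : 0 \in c0_pred.
Proof.
apply/c0_predP; split; first by move=> w; exact: cvg_cst.
move=> e e0; exists set0; first exact: compact0.
by move=> w _; rewrite normr0 ltcR.
Qed.

Lemma c0_predD f g : f \in c0_pred -> g \in c0_pred -> f + g \in c0_pred.
Proof.
move=> /c0_predP[cf vf] /c0_predP[cg vg]; apply/c0_predP; split.
  by move=> w; apply: (@cvgD _ R[i]^o); [exact: cf|exact: cg].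
move=> e e0; have e20 : 0 < e / 2 by rewrite divr_gt0.
have [K cK fK] := vf _ e20; have [L cL gL] := vg _ e20.
exists (K `|` L); first exact: compactU.
move=> w /not_orP[Kw Lw]; apply: (le_lt_trans (ler_normD _ _)).
by rewrite [e]splitr rmorphD ltrD ?fK ?gL.
Qed.

Lemma c0_predZ (k : R[i]) f : f \in c0_pred -> k *: f \in c0_pred.
Proof.
move=> /c0_predP[cf vf]; apply/c0_predP; split.
  by move=> w; apply: (@cvgZl_tmp _ R[i]^o); exact: cf.
move=> e e0; pose M : R := normc k + 1.
have kE : `|k| = (normc k)%:C by [].
have k0 : 0 <= normc k by have := normr_ge0 k; rewrite kE ler0c.
have M0 : 0 < M by rewrite ltr_wpDl.
have [K cK fK] := vf _ (divr_gt0 e0 M0).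
exists K => // w /fK fw; rewrite normrM kE.
apply: (@le_lt_trans _ _ (M%:C * `|f w|)).
  by rewrite ler_wpM2r// lecR lerDl.
have -> : e%:C = M%:C * (e / M)%:C by rewrite -rmorphM mulrC divfK ?gt_eqF.
by rewrite ltr_pM2l// ltcR.
Qed.

Lemma c0_predM f g :
  f \in c0_pred -> g \in c0_pred -> (fun w => f w * g w) \in c0_pred.
Proof.
move=> /c0_predP[cf vf] /c0_predP[cg vg]; apply/c0_predP; split.
  by move=> w; apply: (@cvgZ _ R[i]^o); [exact: cf|exact: cg].
move=> e e0; have [K cK fK] := vf _ e0; have [L cL gL] := vg _ ltr01.
exists (K `|` L); first exact: compactU.
move=> w /not_orP[/fK fw /gL gw]; rewrite normrM -[e%:C]mulr1.
by rewrite ltr_pM.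
Qed.

Lemma c0_predJ f : f \in c0_pred -> (fun w => (f w)^*) \in c0_pred.
Proof.
move=> /c0_predP[cf vf]; apply/c0_predP; split.
  move=> w; apply/(@cvgrPdist_lt _ R[i]^o) => e e0.
  have /(@cvgrPdist_lt _ R[i]^o)/(_ e e0) := cf w.
  by apply: filterS => t /=; rewrite -rmorphB norm_conjC.
by move=> e /vf[K cK fK]; exists K => // w /fK; rewrite norm_conjC.
Qed.

Fact c0_submod_closed : submod_closed c0_pred.
Proof.
split; first exact: c0_pred0.
by move=> k f g cf cg; apply: c0_predD => //; exact: c0_predZ.
Qed.

HB.instance Definition _ :=
  GRing.isSubmodClosed.Build R[i] (T -> R[i]) c0_pred c0_submod_closed.

Record C0 := MkC0 { c0_fun :> T -> R[i]; _ : c0_fun \in c0_pred }.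

HB.instance Definition _ := [isSub for c0_fun].
HB.instance Definition _ := [Choice of C0 by <:].
HB.instance Definition _ := [SubChoice_isSubLmodule of C0 by <:].

Implicit Types a b : C0.

Definition c0_mul a b : C0 := MkC0 (c0_predM (valP a) (valP b)).
Definition c0_conj a : C0 := MkC0 (c0_predJ (valP a)).
Definition c0_norm a : R := sup (range (fun w => normc (a w))).

End C0.
Arguments C0 : clear implicits.

(* The norm of the underlying complete normed module is required to be
   the one induced by the inner product. *)
HB.mixin Record isHilbertC0Module (R : realType) (T : topologicalType) E
    & CompleteNormedModule R[i] E := {
  mact : E -> C0 R T -> E;
  mactDl : forall x y a, mact (x + y) a = mact x a + mact y a;
  mactDr : forall x a b, mact x (a + b) = mact x a + mact x b;
  mactA : forall x a b, mact (mact x a) b = mact x (c0_mul a b);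
  mactZl : forall (k : R[i]) x a, mact (k *: x) a = k *: mact x a;
  mactZr : forall (k : R[i]) x a, mact x (k *: a) = k *: mact x a;
  inner : E -> E -> C0 R T;
  innerDr : forall x y z, inner x (y + z) = inner x y + inner x z;
  innerZr : forall x (k : R[i]) y, inner x (k *: y) = k *: inner x y;
  inner_mact : forall x y a, inner x (mact y a) = c0_mul (inner x y) a;
  innerJ : forall x y, c0_conj (inner x y) = inner y x;
  inner_ge0 : forall x w, 0 <= inner x x w;
  inner_eq0 : forall x, inner x x = 0 -> x = 0;
  norm_inner : forall x, `|x| = (Num.sqrt (c0_norm (inner x x)))%:C
}.

#[short(type="hilbertC0ModType")]
HB.structure Definition HilbertC0Module (R : realType) (T : topologicalType) :=
  {E of CompleteNormedModule R[i] E & isHilbertC0Module R T E}.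

Section fibres.
Context {R : realType} {T : topologicalType}.
Variables (E : hilbertC0ModType R T) (w : T).
Implicit Types x y z : E.

Lemma innerDrE x y z : inner x (y + z) w = inner x y w + inner x z w.
Proof. by rewrite innerDr. Qed.

Lemma innerDlE x y z : inner (x + y) z w = inner x z w + inner y z w.
Proof.
by rewrite -[inner (x + y) z]innerJ /= innerDrE rmorphD /= -2!(innerJ z).
Qed.

Lemma innerNrE x y : inner x (- y) w = - inner x y w.
Proof. by rewrite -scaleN1r innerZr -[RHS]mulN1r. Qed.

Lemma innerNlE x y : inner (- x) y w = - inner x y w.
Proof. by rewrite -[inner (- x) y]innerJ /= innerNrE rmorphN /= -(innerJ y). Qed.

Definition fibre_ker : {pred E} := fun e => `[< inner e e w = 0 >].

Fact fibre_ker_zmod_closed : zmod_closed fibre_ker.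
Proof.
split; first by apply/asboolP; rewrite -[X in inner _ X]oppr0 innerNrE
  -[X in inner X _](subrr 0) innerDlE innerNlE subrr oppr0.
move=> x y /asboolP x0 /asboolP y0; apply/asboolP.
have := inner_ge0 (x - y) w; have := inner_ge0 (x + y) w.
have : inner (x + y) (x + y) w + inner (x - y) (x - y) w = 0.
  rewrite !(innerDlE, innerDrE, innerNlE, innerNrE) x0 y0.
  by rewrite !(oppr0, opprK, add0r, addr0) -opprD subrr.
move=> s0 p q; apply/eqP; rewrite eq_le q andbT.
by rewrite -s0 lerDr.
Qed.

HB.instance Definition _ :=
  GRing.isZmodClosed.Build E fibre_ker fibre_ker_zmod_closed.

Definition fibre : zmodType := Quotient.quot fibre_ker.

End fibres.

Definition fibre_support {R : realType} {T : topologicalType}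
    (E : hilbertC0ModType R T) : set T :=
  [set w | exists xi : fibre E w, xi != 0].

Section module_maps.
Context {R : realType} {T : topologicalType} {E F : hilbertC0ModType R T}.
Implicit Types theta : E -> F.

Definition c0_module_hom theta : Prop :=
  linear theta /\ forall x a, theta (mact x a) = mact (theta x) a.

Definition preserves_orthogonality theta : Prop :=
  forall x y, inner x y = 0 -> inner (theta x) (theta y) = 0.

Definition bounded_operator theta : Prop :=
  exists M : R, forall x, `|theta x| <= M%:C * `|x|.

End module_maps.

(* Main.v *)
(* The element [y <x, x> - x <x, y>] is orthogonal to [x], so applying [theta]
   gives [<theta x, theta y> <x, x> = <theta x, theta x> <x, y>] pointwise.
   Hence, where [<x, x>] does not vanish, [<theta x, theta x> / <x, x>] does
   not depend on [x]; this ratio is the multiplier [phi].  Where [<x, x>]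
   vanishes so does [<theta x, theta x>], because [x = y a] with [a] vanishing
   there too.  Finally [phi] is bounded by a gliding hump argument, and the
   boundedness of [theta] follows. *)

Require Import Defs.
From mathcomp Require Import all_boot all_order all_algebra.
From mathcomp Require Import complex.
From mathcomp Require Import all_classical all_reals all_analysis.
From mathcomp Require Import ring lra.
Import Order.TTheory GRing.Theory Num.Theory.
Import numFieldNormedType.Exports.
Local Open Scope classical_set_scope.
Local Open Scope complex_scope.
Local Open Scope ring_scope.

Set Implicit Arguments.
Unset Strict Implicit.
Unset Printing Implicit Defensive.

(** * Real parts of functions in $C_0(\Omega)$ and continuous functional calculus *)

Section Scalars.
Context {R : realType} {T : topologicalType}.
Implicit Types f : C0 R T.

Lemma ReD (a b : R[i]) : complex.Re (a + b) = complex.Re a + complex.Re b.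
Proof. by case: a b => [a a'] [b b']. Qed.

Lemma ReN (a : R[i]) : complex.Re (- a) = - complex.Re a.
Proof. by case: a. Qed.

Lemma ge0_ReK (a : R[i]) : 0 <= a -> (complex.Re a)%:C = a.
Proof. by case: a => a b; rewrite lecE /= => /andP[/eqP-> _]. Qed.

Lemma conj_real_complex (t : R) : (t%:C)^* = t%:C.
Proof. exact: conjc_real. Qed.

Lemma continuous_Re_C0 f : continuous (fun w => complex.Re (f w)).
Proof.
have /c0_predP[cf _] := valP f => w.
apply/cvgrPdist_lt => e e0.
have e0' : 0 < (e%:C : R[i]) by rewrite ltcR.
have /(@cvgrPdist_lt _ R[i]^o)/(_ _ e0') := cf w.
apply: filterS => t /=; rewrite -ReN -ReD -ltcR.
exact/le_lt_trans/normc_ge_Re.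
Qed.

Lemma Re_C0_vanishes f (e : R) : 0 < e ->
  exists2 K : set T, compact K & forall w, ~ K w -> `|complex.Re (f w)| < e.
Proof.
have /c0_predP[_ vf] := valP f => /vf[K cK fK]; exists K => // w /fK fw.
by rewrite -ltcR; exact: le_lt_trans (normc_ge_Re _) fw.
Qed.

Lemma Re_C0_bounded f : exists B : R, forall w, complex.Re (f w) <= B.
Proof.
have [K cK fK] := Re_C0_vanishes f ltr01.
have /compact_bounded[M [_ bM]] :
    compact [set complex.Re (f w) | w in K].
  apply: continuous_compact => //; apply: continuous_subspaceT.
  exact: continuous_Re_C0.
exists (Num.max 1 (M + 1)) => w; rewrite le_max.
have [Kw|/fK/ltW fw] := pselect (K w).
  apply/orP; right; apply: le_trans (ler_norm _) _.
  by apply: (bM (M + 1)); [rewrite ltrDl | exists w].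
by rewrite (le_trans (ler_norm _) fw).
Qed.

(** The condition [q 0 = 0] makes the result vanish at infinity: [q] is small near 0, and [f] is
    near 0 off a compact set. *)
Lemma continuous_calculus f (q : R -> R) : continuous q -> q 0 = 0 ->
  exists g : C0 R T, forall w, g w = (q (complex.Re (f w)))%:C.
Proof.
move=> cq q0.
suff gP : (fun w => (q (complex.Re (f w)))%:C) \in @c0_pred R T.
  by exists (MkC0 gP).
apply/c0_predP; split=> [w|e e0].
  apply/(@cvgrPdist_lt _ R[i]^o) => e e0.
  have eE : (complex.Re e)%:C = e by apply: ge0_ReK; exact: ltW.
  have e0' : 0 < complex.Re e by rewrite -ltcR eE.
  have : (fun t => q (complex.Re (f t))) @ w --> q (complex.Re (f w)).
    exact: cvg_comp (@continuous_Re_C0 f w) (cq _).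
  move/cvgrPdist_lt/(_ _ e0'); apply: filterS => t /=.
  by rewrite -rmorphB normc_def /= expr0n addr0 sqrtr_sqr -ltcR eE.
have := cq 0; rewrite /continuous_at q0 => /cvgrPdist_lt/(_ _ e0).
case=> d /= d0 qd; have [K cK fK] := Re_C0_vanishes f d0.
exists K => // w /fK fw; rewrite normc_def /= expr0n addr0 sqrtr_sqr ltcR.
by rewrite -normrN -sub0r; apply: qd; rewrite /= sub0r normrN.
Qed.

End Scalars.

(** * The pointwise squared norm $\langle x, x\rangle(\omega)$ *)

Section SquaredNorm.
Context {R : realType} {T : topologicalType} {E : hilbertC0ModType R T}.
Implicit Types (x y : E) (w : T) (a b : C0 R T).

Definition sqnorm x w : R := complex.Re (inner x x w).

Lemma innerE x w : inner x x w = (sqnorm x w)%:C.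
Proof. by rewrite ge0_ReK// inner_ge0. Qed.

Lemma sqnorm_ge0 x w : 0 <= sqnorm x w.
Proof. by rewrite -lecR -innerE inner_ge0. Qed.

Lemma sqnorm_parallelogram x y w :
  sqnorm (x + y) w + sqnorm (x - y) w = 2 * sqnorm x w + 2 * sqnorm y w.
Proof.
apply: complexI; rewrite rmorphD /= -!innerE.
rewrite !(innerDlE, innerDrE, innerNlE, innerNrE).
by rewrite rmorphD !rmorphM /= -!innerE rmorph_nat; ring.
Qed.

Lemma innerJE x y w : inner y x w = (inner x y w)^*.
Proof. by rewrite -innerJ. Qed.

Lemma inner_mactE x y a w : inner x (mact y a) w = inner x y w * a w.
Proof. by rewrite inner_mact. Qed.

Lemma innerZrE x y (k : R[i]) w : inner x (k *: y) w = k * inner x y w.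
Proof. by rewrite innerZr. Qed.

Lemma sqnorm_mact x a w (t : R) :
  a w = t%:C -> sqnorm (mact x a) w = t ^+ 2 * sqnorm x w.
Proof.
move=> aw; apply: complexI; rewrite -innerE inner_mactE innerJE inner_mactE.
rewrite rmorphM /= -innerJE innerE aw rmorphM rmorphXn /=.
by rewrite conj_real_complex; ring.
Qed.

Lemma sqnormN x w : sqnorm (- x) w = sqnorm x w.
Proof. by rewrite /sqnorm innerNlE innerNrE opprK. Qed.

Lemma sqnormZ (t : R) x w : sqnorm (t%:C *: x) w = t ^+ 2 * sqnorm x w.
Proof.
apply: complexI; rewrite -innerE innerZrE innerJE innerZrE.
by rewrite rmorphM /= -innerJE innerE !rmorphM conj_real_complex; ring.
Qed.

Lemma mactBr x a b : mact x (a - b) = mact x a - mact x b.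
Proof. by rewrite mactDr -scaleN1r mactZr scaleN1r. Qed.

Lemma mactBl x y a : mact (x - y) a = mact x a - mact y a.
Proof. by rewrite mactDl -scaleN1r mactZl scaleN1r. Qed.

Lemma normc_inner x w :
  ComplexField.Normc.normc (inner x x w) = sqnorm x w.
Proof.
by rewrite innerE /= expr0n addr0 sqrtr_sqr ger0_norm// sqnorm_ge0.
Qed.

Lemma sqnorm_le x (r : R) w : 0 <= r -> `|x| <= r%:C -> sqnorm x w <= r ^+ 2.
Proof.
move=> r0; rewrite norm_inner lecR => xr.
have [B xB] := Re_C0_bounded (inner x x).
have Nc : sqnorm x w <= c0_norm (inner x x).
  rewrite -normc_inner; apply: (ub_le_sup _ (imageT _ w)).
  by exists B => _ [t _ <-]; rewrite normc_inner; exact: xB.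
apply: (le_trans Nc).
rewrite -(sqr_sqrtr (le_trans (sqnorm_ge0 x w) Nc)).
by rewrite ler_pXn2r// nnegrE sqrtr_ge0.
Qed.

Lemma norm_le_sqnorm x (r : R) : 0 <= r -> (forall w, sqnorm x w <= r ^+ 2) ->
  `|x| <= r%:C.
Proof.
move=> r0 xr; rewrite norm_inner lecR -[r]ger0_norm// -sqrtr_sqr ler_wsqrtr//.
(* On an empty space the norm is the supremum of the empty set, whose default value is 0. *)
have [[w _]|/nonemptyPn T0] := pselect ([set: T] !=set0).
  apply: ge_sup; first by exists (ComplexField.Normc.normc (inner x x w)), w.
  by move=> _ [t _ <-]; rewrite normc_inner.
by rewrite /c0_norm T0 image_set0 sup0 sqr_ge0.
Qed.

Lemma sqnorm_neq0_near x w : sqnorm x w != 0 ->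
  \forall t \near w, sqnorm x t != 0.
Proof.
move=> x0.
have /cvgrPdist_lt/(_ `|sqnorm x w|) := @continuous_Re_C0 _ _ (inner x x) w.
rewrite normr_gt0 => /(_ x0); apply: filterS => t /=.
by apply: contraTneq => xt0; rewrite -/(sqnorm x t) xt0 subr0 ltxx.
Qed.

End SquaredNorm.

(** * Limits with explicit error bounds *)

Section Sequences.
Context {R : realType} {V : completeNormedModType R[i]}.

(** The increments telescope to [r n - r m], at most [r n], so [u] is Cauchy and its limit inherits
    the bound. *)
Lemma cvg_telescoping_bound (u : nat -> V) (r : nat -> R) :
  (forall n, 0 <= r n) -> r @ \oo --> 0 ->
  (forall n, `|u n.+1 - u n| <= (r n - r n.+1)%:C) ->
  exists l, forall n, `|l - u n| <= (r n)%:C.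
Proof.
move=> r0 rcvg ur.
have umn m n : `|u (n + m)%N - u n| <= (r n - r (n + m)%N)%:C.
  elim: m => [|m IH]; first by rewrite addn0 !subrr normr0 lexx.
  rewrite addnS -(subrKA (u (n + m)%N)) -(subrKA (r (n + m)%N) (r n)).
  rewrite addrC [_ + (r _ - _)]addrC rmorphD /= [in leRHS]addrC.
  by apply: le_trans (ler_normD _ _) _; rewrite lerD.
have urn m n : (n <= m)%N -> `|u m - u n| <= (r n)%:C.
  move=> nm; rewrite -(subnKC nm); apply: le_trans (umn _ _) _.
  by rewrite lecR gerBl.
have /cvg_ex[l ul] : cvg (u @ \oo).
  apply: cauchy_cvg; apply: cauchy_exP => e e0.
  have eE : (complex.Re e)%:C = e by apply: ge0_ReK; exact: ltW.
  have e0' : 0 < complex.Re e by rewrite -ltcR eE.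
  have /cvgrPdist_lt/(_ _ e0')[N _ rN] := rcvg.
  exists (u N), N => // m /= Nm; rewrite -ball_normE /= distrC.
  apply: le_lt_trans (urn _ _ Nm) _; rewrite -eE ltcR.
  by have := rN N (leqnn N); rewrite /= sub0r normrN ger0_norm.
exists l => n; apply/ler_addgt0Pr => e e0.
have /cvgrPdist_lt/(_ _ e0)[N _ uN] := ul.
rewrite -(subrKA (u (N + n)%N)); apply: le_trans (ler_normD _ _) _.
rewrite addrC lerD// ?urn ?leq_addl//.
by apply/ltW/uN; rewrite /= leq_addr.
Qed.

End Sequences.

(** * Factorization of module elements through a fourth root *)

Section Factorization.
Context {R : realType}.

Definition root4 (t : R) : R := Num.sqrt (Num.sqrt t).

(** A regularized inverse of [root4 t]: it is continuous and vanishes at 0 for [d > 0], and tends to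
    $t^{-1/4}$ as [d] tends to 0 when [t > 0]. *)
Definition root4_inv (d t : R) : R := root4 t / (root4 t ^+ 2 + d ^+ 2).

Lemma root4_expr4 t : 0 <= t -> root4 t ^+ 4 = t.
Proof. by move=> t0; rewrite (exprM _ 2 2) !sqr_sqrtr// sqrtr_ge0. Qed.

Lemma root4_0 : root4 0 = 0.
Proof. by rewrite /root4 !sqrtr0. Qed.

Lemma continuous_root4 : continuous root4.
Proof. by move=> t; apply: cvg_comp; exact: sqrt_continuous. Qed.

Lemma continuous_root4_inv d : 0 < d -> continuous (root4_inv d).
Proof.
move=> d0 t; apply: cvgM; first exact: continuous_root4.
apply: cvgV; first by rewrite gt_eqF// ltr_wpDl ?sqr_ge0 ?exprn_gt0.
apply: cvgD; last exact: cvg_cst.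
by rewrite expr2; apply: cvgM; exact: continuous_root4.
Qed.

(** This makes $x \langle x, x\rangle^{-1/4}$ a uniform limit: halving [d] moves the approximant by
    at most [d / 2], which is summable. *)
Lemma root4_inv_half (d t : R) : 0 < d -> 0 <= t ->
  (root4_inv (d / 2) t - root4_inv d t) ^+ 2 * t <= (d / 2) ^+ 2.
Proof.
move=> d0 t0; rewrite -[X in _ * X]root4_expr4// /root4_inv.
set g := root4 t; have g0 : 0 <= g by exact: sqrtr_ge0.
set p := g ^+ 2 + (d / 2) ^+ 2; set s := g ^+ 2 + d ^+ 2.
have p0 : 0 < p by rewrite /p; nra.
have s0 : 0 < s by rewrite /s; nra.
(* Here [s - p] is [3 / 4 * d ^+ 2]. The factor [g ^+ 2 / p] is at most 1, and [g * d / s] at most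
   1/2 since $(g - d)^2 \ge 0$, so the base is at most [3 / 8 * d]. *)
have -> : (g / p - g / s) ^+ 2 * g ^+ 4 =
          ((g ^+ 2 / p) * (3 / 4 * d * (g * d / s))) ^+ 2.
  have -> : g / p - g / s = g * (3 / 4 * d ^+ 2) / (p * s).
    have -> : 3 / 4 * d ^+ 2 = s - p by rewrite /s /p; field.
    by field; rewrite !gt_eqF.
  by field; rewrite !gt_eqF.
have gp : 0 <= g ^+ 2 / p <= 1.
  by rewrite divr_ge0 ?sqr_ge0 ?(ltW p0)//= ler_pdivrMr// mul1r /p; nra.
have gs : 0 <= g * d / s <= 1 / 2.
  rewrite divr_ge0 ?mulr_ge0 ?(ltW s0) ?(ltW d0)//= ler_pdivrMr// /s.
  by have := sqr_ge0 (g - d); nra.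
move: gp gs; move: (g ^+ 2 / p) (g * d / s) => u v /andP[u0 u1] /andP[v0 v1].
have v0' : 0 <= 3 / 4 * d * v by nra.
rewrite ler_pXn2r ?nnegrE ?mulr_ge0//; [|lra..].
have -> : d / 2 = 1 * (d / 2) by rewrite mul1r.
by apply: ler_pM => //; nra.
Qed.

Lemma root4_inv_close (d t : R) : 0 < d -> 0 <= t ->
  (1 - root4_inv d t * root4 t) ^+ 2 * t <= d ^+ 4.
Proof.
move=> d0 t0; rewrite -[X in _ * X]root4_expr4// /root4_inv.
set g := root4 t; have g0 : 0 <= g by exact: sqrtr_ge0.
set s := g ^+ 2 + d ^+ 2.
have s0 : 0 < s by rewrite /s; nra.
have -> : (1 - g / s * g) ^+ 2 * g ^+ 4 = (d ^+ 2 * (g ^+ 2 / s)) ^+ 2.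
  have -> : 1 - g / s * g = d ^+ 2 / s.
    have -> : d ^+ 2 = s - g ^+ 2 by rewrite /s; ring.
    by field; rewrite gt_eqF.
  by field; rewrite gt_eqF.
have gs : 0 <= g ^+ 2 / s <= 1.
  by rewrite divr_ge0 ?sqr_ge0 ?(ltW s0)//= ler_pdivrMr// mul1r /s; nra.
move: gs; move: (g ^+ 2 / s) => u /andP[u0 u1].
rewrite (exprM _ 2 2) ler_pXn2r ?nnegrE ?mulr_ge0 ?(ltW d0)//.
by rewrite ler_piMr ?sqr_ge0.
Qed.

Context {T : topologicalType} {E : hilbertC0ModType R T}.
Implicit Types (x y : E) (w : T).

Lemma sqnorm_eq0 x : (forall w, sqnorm x w = 0) -> x = 0.
Proof.
move=> x0; apply: (@inner_eq0 R T); apply: val_inj; apply/funext => w.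
by rewrite /= innerE x0.
Qed.

Lemma sqnormD_le x y w : sqnorm (x + y) w <= 2 * sqnorm x w + 2 * sqnorm y w.
Proof. by rewrite -sqnorm_parallelogram lerDl sqnorm_ge0. Qed.

Lemma sqnormB_mact x (a : C0 R T) w (t : R) :
  a w = t%:C -> sqnorm (x - mact x a) w = (1 - t) ^+ 2 * sqnorm x w.
Proof.
move=> aw; apply: complexI; rewrite -innerE.
rewrite !(innerDlE, innerDrE, innerNlE, innerNrE).
rewrite !(inner_mactE, innerJE _ (mact _ _)) innerE aw.
rewrite -rmorphM /= conj_real_complex !(rmorphM, rmorphXn, rmorphB) rmorph1.
by ring.
Qed.

(* As [E] is complete, [y = x <x, x>^(-1/4)] makes sense. *)
Lemma factor_vanishing x :
  exists y a, x = mact y a /\ forall w, sqnorm x w = 0 -> a w = 0.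
Proof.
pose d n : R := (1 / 2) ^+ n.
have d0 n : 0 < d n by rewrite /d exprn_gt0// divr_gt0.
have dS n : d n.+1 = d n / 2 by rewrite /d exprSr; field.
have dcvg : d @ \oo --> 0.
  by apply: cvg_expr; rewrite ger0_norm; lra.
have calc n : exists b : C0 R T,
    forall w, b w = (root4_inv (d n) (sqnorm x w))%:C.
  apply: continuous_calculus; first exact: continuous_root4_inv.
  by rewrite /root4_inv root4_0 mul0r.
have [b bE] := choice calc.
have [a aE] := continuous_calculus (inner x x) continuous_root4 root4_0.
have [y yu] : exists y, forall n, `|y - mact x (b n)| <= (d n)%:C.
  apply: cvg_telescoping_bound => // [n|n]; first exact: ltW.
  have -> : d n - d n.+1 = d n / 2 by rewrite dS; field.
  rewrite -mactBr; apply: norm_le_sqnorm => [|w].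
    by rewrite divr_ge0// ltW.
  rewrite (@sqnorm_mact _ _ _ _ _ _
    (root4_inv (d n / 2) (sqnorm x w) - root4_inv (d n) (sqnorm x w))).
    by apply: root4_inv_half => //; exact: sqnorm_ge0.
  by rewrite rmorphB /= -dS -!bE.
exists y, a; split; last by move=> w xw; rewrite aE -/(sqnorm x w) xw root4_0.
apply/eqP; rewrite -subr_eq0; apply/eqP/sqnorm_eq0 => w.
set g := root4 (sqnorm x w).
(* Split $x - ya$ as $(x - x b_n a) + (x b_n - y) a$. The squared norms are at most $d_n^4 \le
   d_n^2$ and $g^2 d_n^2$. *)
have bound n : sqnorm (x - mact y a) w <= (2 + 2 * g ^+ 2) * d n ^+ 2.
  rewrite -(subrKA (mact (mact x (b n)) a)).
  apply: le_trans (sqnormD_le _ _ _) _.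
  have -> : sqnorm (mact (mact x (b n)) a - mact y a) w =
            g ^+ 2 * sqnorm (y - mact x (b n)) w.
    by rewrite -mactBl (sqnorm_mact _ (aE w)) -opprB sqnormN.
  have yn := sqnorm_le w (ltW (d0 n)) (yu n).
  have -> : sqnorm (x - mact (mact x (b n)) a) w =
      (1 - root4_inv (d n) (sqnorm x w) * g) ^+ 2 * sqnorm x w.
    by rewrite mactA; apply: sqnormB_mact; rewrite /= bE aE -rmorphM.
  have := root4_inv_close (d0 n) (sqnorm_ge0 x w).
  have : d n ^+ 4 <= d n ^+ 2.
    have d1 : d n <= 1 by rewrite /d exprn_ile1//; lra.
    by apply: ler_wiXn2l; rewrite // ltW.
  rewrite -/g => close dd.
  have : g ^+ 2 * sqnorm (y - mact x (b n)) w <= g ^+ 2 * d n ^+ 2.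
    by rewrite ler_wpM2l ?sqr_ge0.
  by lra.
apply/eqP; rewrite eq_le sqnorm_ge0 andbT; apply/ler_addgt0Pr => e e0.
rewrite add0r.
set c := 2 + 2 * g ^+ 2 in bound.
have c0 : 0 < c by rewrite /c; nra.
have /cvgrPdist_lt/(_ _ (divr_gt0 e0 c0))[N _ /(_ N (leqnn N))] := dcvg.
rewrite /= sub0r normrN gtr0_norm// => dN.
apply: le_trans (bound N) _.
rewrite mulrC -ler_pdivlMr//; apply: le_trans (ltW dN).
have d1 : d N <= 1 by rewrite /d exprn_ile1//; lra.
by rewrite expr2 ler_piMr// ltW.
Qed.

(** The factorization takes the place of the Cauchy-Schwarz inequality here. *)
Lemma inner_vanishes x y w : sqnorm x w = 0 -> inner y x w = 0.
Proof.
have [z [a [-> aP]]] := factor_vanishing x => /aP a0.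
by rewrite inner_mactE a0 mulr0.
Qed.

End Factorization.

(** * Peak elements and boundedness of a multiplier *)

Section Multiplier.
Context {R : realType} {T : topologicalType} {E F : hilbertC0ModType R T}.

Lemma peak (x : E) w : sqnorm x w != 0 ->
  exists2 x' : E, `|x'| <= 1 & sqnorm x' w = 1.
Proof.
set c := sqnorm x w => c_neq0.
have c0 : 0 < c by rewrite lt_neqAle eq_sym c_neq0 sqnorm_ge0.
(* For [t >= 0], $q(t)^2 t = (4ct/(t+c)^2)^2$, which is at most 1 and equals 1 at [t = c]. Writing
   [Num.sqrt t ^+ 2] for [t] keeps the denominator positive for negative [t]. *)
pose q (t : R) := 4 * c * Num.sqrt t / (Num.sqrt t ^+ 2 + c) ^+ 2.
have den t : 0 < Num.sqrt t ^+ 2 + c by rewrite ltr_wpDl ?sqr_ge0.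
have cq : continuous q.
  move=> t; apply: cvgM.
    by apply: cvgM; [exact: cvg_cst|exact: sqrt_continuous].
  apply: cvgV; first by rewrite gt_eqF ?exprn_gt0.
  have cden : Num.sqrt u ^+ 2 + c @[u --> t] --> Num.sqrt t ^+ 2 + c.
    apply: cvgD; last exact: cvg_cst.
    by rewrite expr2; apply: cvgM; exact: sqrt_continuous.
  by rewrite expr2; apply: cvgM.
have q0 : q 0 = 0 by rewrite /q sqrtr0 mulr0 mul0r.
have [a aE] := continuous_calculus (inner x x) cq q0.
have NE u : sqnorm (mact x a) u =
    (4 * sqnorm x u * c / (sqnorm x u + c) ^+ 2) ^+ 2.
  rewrite (sqnorm_mact _ (aE u)) -/(sqnorm x u) /q.
  have := den (sqnorm x u); have := sqr_sqrtr (sqnorm_ge0 x u).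
  move: (Num.sqrt _) => g <- gc; field.
  by rewrite gt_eqF.
exists (mact x a); last first.
  by rewrite NE -/c; field; rewrite gt_eqF// -mulr2n pmulrn_rgt0.
apply: norm_le_sqnorm => // u; rewrite NE ler_pXn2r ?nnegrE//.
  have t0 := sqnorm_ge0 x u; rewrite ler_pdivrMr ?exprn_gt0 ?ltr_wpDl// mul1r.
  by have := sqr_ge0 (sqnorm x u - c); nra.
by rewrite divr_ge0 ?exprn_ge0 ?addr_ge0 ?mulr_ge0 ?sqnorm_ge0// ltW.
Qed.

(* Gliding hump: if [phi] were unbounded, the peaks [x n] at points [w n] where
   [phi] is huge, added with weights [4^-n] and signs chosen so that the hump
   at [w n] survives, would give [l] with [theta l] unbounded. *)
Lemma multiplier_bounded (theta : E -> F) (phi : T -> R) :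
  (forall w, 0 <= phi w) ->
  (forall x w, sqnorm (theta x) w = phi w * sqnorm x w) ->
  exists B : R, forall (x : E) w, sqnorm x w != 0 -> phi w <= B.
Proof.
move=> phi0 thetaE; apply: contrapT => unbounded.
pose c n : R := (1 / 4) ^+ n.
have c0 n : 0 < c n by rewrite exprn_gt0//; lra.
have cS n : c n.+1 = c n / 4 by rewrite /c exprSr; field.
(* The threshold is chosen because the limit will keep squared norm at least [c n ^+ 2 / 4] at the
   [n]-th point, so its image has squared norm at least [n] there. *)
have hump n : exists xw : E * T,
    [/\ `|xw.1| <= 1, sqnorm xw.1 xw.2 = 1 & 4 * n%:R / c n ^+ 2 < phi xw.2].
  apply: contrapT => small; apply: unbounded.
  exists (4 * n%:R / c n ^+ 2) => x w /peak[x' x'1 x'w].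
  by rewrite leNgt; apply/negP => big; apply: small; exists (x', w).
have [xw xwP] := choice hump.
pose x n := (xw n).1; pose w n := (xw n).2.
pose step n y := if c n ^+ 2 <= sqnorm (y + (c n)%:C *: x n) (w n)
  then y + (c n)%:C *: x n else y - (c n)%:C *: x n.
pose y := fix y n := if n is n'.+1 then step n' (y n') else 0.
(* By the parallelogram law the two sign choices have squared norms at [w n] summing to at least
   [2 * c n ^+ 2], so one of them reaches [c n ^+ 2]. *)
have step_hump n : c n ^+ 2 <= sqnorm (y n.+1) (w n).
  rewrite /= /step; case: ifPn => //; rewrite -ltNge.
  have := sqnorm_parallelogram (y n) ((c n)%:C *: x n) (w n).
  have [_ + _] := xwP n; rewrite -/(x n) -/(w n) sqnormZ => ->.
  by have := sqnorm_ge0 (y n) (w n); lra.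
have step_small n : `|y n.+1 - y n| <= (c n)%:C.
  have cx : `|(c n)%:C *: x n| <= (c n)%:C.
    have [x1 _ _] := xwP n.
    rewrite normrZ [`|(c n)%:C|]ger0_norm ?ler0c ?(ltW (c0 n))//.
    by rewrite ler_piMr ?ler0c ?(ltW (c0 n)).
  rewrite -[y n.+1]/(step n (y n)) /step.
  by case: ifPn => _; rewrite [y n + _]addrC addrK ?normrN.
have ccvg : (fun n => 2 * c n) @ \oo --> 0.
  by apply: cvg_geometric; rewrite ger0_norm; lra.
have [l yl] : exists l, forall n, `|l - y n| <= (2 * c n)%:C.
  apply: cvg_telescoping_bound => // n; first by rewrite mulr_ge0// ltW.
  apply: le_trans (step_small n) _; rewrite lecR cS.
  by have := c0 n; lra.
have [B lB] := Re_C0_bounded (inner (theta l) (theta l)).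
have [n Bn] : exists n, B < n%:R.
  by exists (Num.truncn B).+1; exact: truncnS_gt.
have := lB (w n); rewrite -/(sqnorm _ _) thetaE leNgt => /negP; apply.
apply: (lt_le_trans Bn).
(* The later humps move the limit by at most [2 * c n.+1], that is [c n / 2], which cannot cancel
   the hump at [w n]. *)
have l_hump : c n ^+ 2 / 4 <= sqnorm l (w n).
  have := sqnormD_le l (y n.+1 - l) (w n); rewrite subrKC -opprB sqnormN.
  have := sqnorm_le (w n) (mulr_ge0 (ler0n _ 2) (ltW (c0 n.+1))) (yl n.+1).
  by rewrite cS; have := step_hump n; lra.
have [_ _ /ltW] := xwP n; rewrite -/(w n) => big.
have -> : n%:R = 4 * n%:R / c n ^+ 2 * (c n ^+ 2 / 4) :> R.
  by field; rewrite gt_eqF.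
have c2 : 0 <= c n ^+ 2 by exact: sqr_ge0.
apply: ler_pM; rewrite // divr_ge0 // mulr_ge0.
Qed.

End Multiplier.

(** * The multiplier of an orthogonality preserving module map *)

Section OrthogonalityPreserver.
Context {R : realType} {T : topologicalType} {E F : hilbertC0ModType R T}.
Context (theta : E -> F) (theta_linear : linear theta)
  (theta_mact : forall x a, theta (mact x a) = mact (theta x) a)
  (theta_orth : preserves_orthogonality theta).

Lemma thetaD x y : theta (x + y) = theta x + theta y.
Proof. by rewrite -[x in LHS]scale1r theta_linear scale1r. Qed.

Lemma thetaB x y : theta (x - y) = theta x - theta y.
Proof. by rewrite addrC -scaleN1r theta_linear scaleN1r addrC. Qed.

(** Continuity of [theta] is not yet known, so no approximation of [x] may be used; an exact
    factorization passes through [theta] by module linearity. *)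
Lemma theta_vanishes x w : sqnorm x w = 0 ->
  sqnorm (theta x) w = 0 /\ forall y, inner (theta y) (theta x) w = 0.
Proof.
have [y [a [-> aP]]] := factor_vanishing x => /aP a0.
rewrite theta_mact; split=> [|z]; last by rewrite inner_mactE a0 mulr0.
by rewrite (@sqnorm_mact _ _ _ _ _ _ 0)// expr2 !mul0r.
Qed.

Lemma inner_theta x y w :
  inner (theta x) (theta y) w * inner x x w =
  inner (theta x) (theta x) w * inner x y w.
Proof.
have /theta_orth/(congr1 (fun f : C0 R T => f w)) :
    inner x (mact y (inner x x) - mact x (inner x y)) = 0.
  apply: val_inj; apply/funext => v.
  by rewrite /= innerDrE innerNrE !inner_mactE mulrC subrr.
rewrite thetaB !theta_mact innerDrE innerNrE !inner_mactE => /eqP.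
by rewrite subr_eq0 => /eqP.
Qed.

Lemma sqnorm_theta_ratio x y w :
  sqnorm (theta x) w * sqnorm y w = sqnorm (theta y) w * sqnorm x w.
Proof.
have [x0|x0] := eqVneq (sqnorm x w) 0.
  by rewrite x0 (theta_vanishes x0).1 mul0r mulr0.
have xC0 : inner x x w != 0.
  by rewrite innerE; apply: contra_neq x0 => /complexI.
(* Combine [inner_theta x z] with the conjugate of [inner_theta z x]: both express $\langle\theta x,
   \theta z\rangle$ as a multiple of $\langle x, z\rangle$, which is then cancelled. *)
have nonorth z : inner x z w != 0 ->
    sqnorm (theta x) w * sqnorm z w = sqnorm (theta z) w * sqnorm x w.
  move=> xz0; apply: complexI; apply: (mulIf xz0).
  rewrite !rmorphM /= -!innerE mulrAC -inner_theta [RHS]mulrAC.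
  have := congr1 (fun u => u^*) (inner_theta z x w).
  by rewrite !rmorphM /= -!innerJE => <-; rewrite mulrAC.
have [xy0|] := eqVneq (inner x y w) 0; last exact: nonorth.
(* If [y] is orthogonal to [x] at [w], then [x + y] is not. *)
have := nonorth (x + y).
have txy : inner (theta x) (theta y) w = 0.
  by apply: (mulIf xC0); rewrite inner_theta xy0 mulr0 mul0r.
rewrite thetaD /sqnorm !(innerDrE, innerDlE) xy0 txy.
rewrite (innerJE x y) (innerJE (theta x) (theta y)) xy0 txy conjC0.
rewrite !addr0 !add0r.
(* The cross terms are gone, and both sides share the summand [sqnorm (theta x) w * sqnorm x w]. *)
by move=> /(_ xC0); rewrite !ReD mulrDl mulrDr => /addrI.
Qed.

(* Off the support of [E], [e] is the default [0] and the value is [0 / 0 = 0]. *)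
Definition multiplier w : R :=
  let e := xget 0 [set e : E | sqnorm e w != 0] in
  sqnorm (theta e) w / sqnorm e w.

Lemma multiplier_ge0 w : 0 <= multiplier w.
Proof. by rewrite divr_ge0// sqnorm_ge0. Qed.

Lemma sqnorm_theta x w : sqnorm (theta x) w = multiplier w * sqnorm x w.
Proof.
have [x0|x0] := eqVneq (sqnorm x w) 0.
  by rewrite x0 (theta_vanishes x0).1 mulr0.
rewrite /multiplier; case: xgetP => [e _ /= e0|/(_ x)/=]; last by rewrite x0.
by rewrite mulrAC -sqnorm_theta_ratio mulfK.
Qed.

Lemma inner_theta_multiplier x y w :
  inner (theta x) (theta y) w = (multiplier w)%:C * inner x y w.
Proof.
have [x0|x0] := eqVneq (sqnorm x w) 0.
  rewrite innerJE (theta_vanishes x0).2 (innerJE y) inner_vanishes//.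
  by rewrite conjC0 mulr0.
have xC0 : inner x x w != 0.
  by rewrite innerE; apply: contra_neq x0 => /complexI.
apply: (mulIf xC0).
by rewrite inner_theta !innerE sqnorm_theta rmorphM mulrAC.
Qed.

(** The element chosen in [multiplier] varies with the point, but one fixed [x] computes the same
    ratio on a whole neighbourhood of [w]. *)
Lemma continuous_multiplier (x : E) w :
  sqnorm x w != 0 -> {for w, continuous multiplier}.
Proof.
move=> x0.
have near0 := sqnorm_neq0_near x0.
rewrite /prop_for /continuous_at.
have -> : multiplier w = sqnorm (theta x) w / sqnorm x w.
  by rewrite sqnorm_theta mulfK.
apply: cvg_trans (_ : (fun t => sqnorm (theta x) t / sqnorm x t) @ w --> _).
  apply: near_eq_cvg; apply: filterS near0 => t xt.
  by rewrite sqnorm_theta mulfK.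
apply: cvgM; first exact: continuous_Re_C0.
by apply: cvgV => //; exact: continuous_Re_C0.
Qed.

End OrthogonalityPreserver.

(** * Nonzero fibres in terms of the inner product *)

Section FibreSupport.
Local Open Scope quotient_scope.

Lemma fibre_supportP (R : realType) (T : topologicalType)
    (E : hilbertC0ModType R T) w :
  fibre_support E w <-> exists x : E, sqnorm x w != 0.
Proof.
have pi_eq0 (x : E) : (\pi_(fibre E w) x == 0) = (sqnorm x w == 0).
  rewrite -[0](raddf0 \pi_(fibre E w)) -Quotient.idealrBE subr0.
  by apply/asboolP/eqP; rewrite innerE; [exact: complexI|move=> ->].
split=> [[xi xi0]|[x x0]]; last by exists (\pi x); rewrite pi_eq0.
by exists (repr xi); rewrite -pi_eq0 reprK.
Qed.

End FibreSupport.

Theorem corollary3p7 (R : realType) (Omega : topologicalType)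
    (Omega_hausdorff : hausdorff_space Omega)
    (Omega_lcompact : locally_compact [set: Omega])
    (E F : hilbertC0ModType R Omega) (theta : E -> F)
    (theta_hom : c0_module_hom theta)
    (theta_orth : preserves_orthogonality theta) :
  bounded_operator theta /\
  exists phi : Omega -> R,
    [/\ forall w, 0 <= phi w,
        bounded_fun phi,
        {within fibre_support E, continuous phi} &
        forall e f w, inner (theta e) (theta f) w = (phi w)%:C * inner e f w].
Proof.
have [theta_lin theta_mact] := theta_hom.
have thetaE := sqnorm_theta theta_lin theta_mact theta_orth.
have [B phiB] := multiplier_bounded (multiplier_ge0 theta) thetaE.
(* [B] bounds the multiplier only where some squared norm is nonzero; elsewhere the value is 0, and
   [B] itself may be negative if there is no such point. *)
have {}phiB w : multiplier theta w <= Num.max 0 B.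
  rewrite le_max.
  have [[x /phiB ->]|no] := pselect (exists x : E, sqnorm x w != 0).
    by rewrite orbT.
  rewrite /multiplier; set e := xget _ _.
  suff -> : sqnorm e w = 0 by rewrite invr0 mulr0 lexx.
  by apply/eqP/negPn/negP => e0; apply: no; exists e.
have B0 : 0 <= Num.max 0 B by rewrite le_max lexx.
split.
  exists (Num.sqrt (Num.max 0 B)) => x.
  have xE : (complex.Re `|x|)%:C = `|x| by exact: ge0_ReK.
  have x0 : 0 <= complex.Re `|x| by rewrite -ler0c xE.
  rewrite -xE -rmorphM; apply: norm_le_sqnorm => [|w].
    by rewrite mulr_ge0 ?sqrtr_ge0.
  rewrite thetaE exprMn sqr_sqrtr//; apply: ler_pM => //.
  - exact: multiplier_ge0.
  - exact: sqnorm_ge0.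
  - by apply: sqnorm_le => //; rewrite xE.
exists (multiplier theta); split.
- exact: multiplier_ge0.
- exists (Num.max 0 B); split; first exact: num_real.
  move=> M /ltW BM w _ /=; rewrite ger0_norm ?multiplier_ge0//.
  exact: le_trans (phiB w) BM.
(* The support is open, so relative continuity reduces to continuity at each of its points. *)
- rewrite continuous_open_subspace.
    move=> w; rewrite inE => /fibre_supportP[x].
    exact: continuous_multiplier.
  rewrite openE => w /fibre_supportP[x x0].
  have := sqnorm_neq0_near x0; apply: filterS => t xt.
  by apply/fibre_supportP; exists x.
- exact: inner_theta_multiplier.
Qed.
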